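(* Let $q$ be a prime power. For every integer $m\ge1$, the length $n=q^m-1$ is not exceptional for $q$; that is, $\operatorname{Aut}_q(q^m-1)=\operatorname{Aff}_q(q^m-1)$.
   Context: For a positive integer $n$ coprime to $q$, let $\mathbb{Z}_n=\mathbb{Z}/n\mathbb{Z}$ and let $\langle q\rangle$ be the subgroup of $\mathbb{Z}_n^\times$ generated by $q$. The cyclotomic association scheme $\operatorname{Cyc}(\langle q\rangle,\mathbb{Z}_n)$ is the pair $(\mathbb{Z}_n,\pi)$ with coloring $\pi(x,y):=(y-x)\langle q\rangle$ (the orbit of $y-x$ under multiplication by $\langle q\rangle$), and $\operatorname{Aut}_q(n):=\operatorname{Aut}(\operatorname{Cyc}(\langle q\rangle,\mathbb{Z}_n))$ is the group of all permutations $\sigma$ of $\mathbb{Z}_n$ with $\pi(\sigma x,\sigma y)=\pi(x,y)$ for all $x,y\in\mathbb{Z}_n$. The $q$-affine group is $\operatorname{Aff}_q(n):=\{x\mapsto kx+b:\ k\in\langle q\rangle,\ b\in\mathbb{Z}_n\}\le\operatorname{Sym}(\mathbb{Z}_n)$, a subgroup of $\operatorname{Aut}_q(n)$. The integer $n$ is called an exceptional length for $q$ if $\operatorname{Aut}_q(n)\neq\operatorname{Aff}_q(n)$. *)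

(* Defs.v *)
From mathcomp Require Import all_boot all_order all_algebra all_fingroup.

Set Implicit Arguments.
Unset Strict Implicit.
Unset Printing Implicit Defensive.

Import GroupScope GRing.Theory.

Definition prime_power (q : nat) : Prop :=
  exists p k : nat, [/\ prime p, 0 < k & q = p ^ k]%N.

(* For n > 0, Z/nZ is the subset [Zp n] of ['Z_n], which has n elements.  For
   n > 1 it is all of ['Z_n]; for n = 1 the type ['Z_1] is Z/2Z, but
   [Zp 1] = {0} and the unit group of ['Z_1] is trivial, as they should be.
   Permutations of Z/nZ are the elements of [Sym (Zp n)], that is, the
   permutations of the type ['Z_n] which fix everything outside [Zp n]. *)

(* The set under <<_>> is the singleton of the class of q when q is coprime to
   n > 1, and this avoids carrying a coprimality proof. *)
Definition qgroup (q n : nat) : {set {unit 'Z_n}} :=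
  <<[set u : {unit 'Z_n} | val u == (q%:R : 'Z_n)%R]>>.

Definition cyc_color (q n : nat) (x y : 'Z_n) : {set 'Z_n} :=
  [set ((y - x) * val k)%R | k in qgroup q n].

Definition Aut_q (q n : nat) : {set {perm 'Z_n}} :=
  [set s in Sym (Zp n) | [forall x in Zp n, forall y in Zp n,
    cyc_color q (s x) (s y) == cyc_color q x y]].

Definition Aff_q (q n : nat) : {set {perm 'Z_n}} :=
  [set s in Sym (Zp n) | [exists k in qgroup q n, exists b in Zp n,
    forall x in Zp n, s x == (val k * x + b)%R]].

Definition exceptional_length (q n : nat) : Prop := Aut_q q n <> Aff_q q n.

(* Main.v *)
(* Let w be a primitive n-th root of unity in F_(q^m), with n = q^m - 1, let
   chi x = w^x, and let H = <q>.  A color preserving s commutes with every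
   circulant operator whose kernel is H-invariant, so chi (j * s x) is a
   combination of the characters chi (k * x) with k in jH.  For j = 1 this reads
   chi (s x) = \sum_(v in H) a_v chi (v * x).  Multiply this by its u-th power,
   for u <> 1 in H, which Frobenius also expands linearly: the left-hand side
   becomes chi ((1 + u) * s x).  In H, x + y = 2 c forces x = y = c, because
   0 <= q^a + q^b - 2 < q^m - 1 for a, b < m (take c = 1).  Hence the
   coefficient at 2 c of the product is a_c a_(c/u)^u, and it vanishes as 2 c is
   not in (1 + u)H.  So only one a_v is nonzero, and s x = v * x + s 0. *)

Require Import Defs.
From mathcomp Require Import all_boot all_order all_algebra all_fingroup.
From mathcomp Require Import all_solvable all_field zify.

Set Implicit Arguments.
Unset Strict Implicit.
Unset Printing Implicit Defensive.

Import GRing.Theory.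

(** * Field-valued additive characters of a finite commutative ring *)

Lemma sum_exp_pchar (F : fieldType) (I : finType) (P : pred I) (G : I -> F) U :
  [pchar F]%R.-nat U ->
  ((\sum_(i | P i) G i) ^+ U = \sum_(i | P i) G i ^+ U)%R.
Proof.
move=> pU; apply: (big_morph (fun x => x ^+ U)%R) => [x y|].
  exact: exprDn_pchar.
by rewrite expr0n; case: U pU.
Qed.

Section AdditiveCharacter.

Local Open Scope ring_scope.

Variables (R : finComUnitRingType) (F : fieldType) (chi : R -> F).
Hypothesis chi0 : chi 0 = 1.
Hypothesis chiD : forall x y, chi (x + y) = chi x * chi y.
Hypothesis chi_inj : forall x, chi x = 1 -> x = 0.

Lemma char_mulrn x U : chi (x *+ U) = chi x ^+ U.
Proof. by elim: U => [|U IH]; rewrite ?mulr0n // mulrS exprS chiD IH. Qed.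

(** Shifting the summation variable by 1 multiplies the sum by [chi l], which differs from 1 when
    [l] is nonzero. *)
Lemma char_sum (l : R) :
  \sum_x chi (l * x) = if l == 0 then #|R|%:R else 0.
Proof.
case: eqP => [->|/eqP l0].
  rewrite (eq_bigr (fun _ => 1)) => [|x _]; last by rewrite mul0r chi0.
  by rewrite sumr_const.
have chil : chi l - 1 != 0.
  by apply: contra l0; rewrite subr_eq0 => /eqP /chi_inj ->.
apply: (mulfI chil); rewrite mulr0 mulrBl mul1r mulr_sumr.
rewrite [X in _ - X](reindex_inj (addrI 1)) /= -sumrB big1 // => x _.
by rewrite mulrDr mulr1 chiD subrr.
Qed.

Hypothesis cardR : #|R|%:R != 0 :> F.

Lemma char_inversion (g : R -> F) x :
  g x = \sum_k (#|R|%:R^-1 * \sum_y g y * chi (- (k * y))) * chi (k * x).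
Proof.
apply: (mulfI cardR); rewrite mulr_sumr.
under eq_bigr => k _ do rewrite -mulrA mulVKf // mulr_suml.
rewrite exchange_big (bigD1 x) //= [X in _ + X]big1 ?addr0 => [|y yx].
  under eq_bigr => k _ do rewrite -mulrA -chiD addNr chi0 mulr1.
  by rewrite sumr_const mulr_natl.
under eq_bigr => k _ do
  rewrite -mulrA -chiD addrC -mulrBr [k * _]mulrC.
by rewrite -mulr_sumr char_sum subr_eq0 eq_sym (negPf yx) mulr0.
Qed.

Variable H : {group {unit R}}.

Section ColorPreserving.

Variable s : R -> R.
Hypothesis s_bij : bijective s.
Hypothesis sP : forall x y, exists2 v, v \in H & s y - s x = (y - x) * val v.

(* The kernel [f (x - y)] is the same as [f (s x - s y)], and [f] has nonzero
   Fourier transform at [j] but not at [k]; evaluating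
   [\sum_(x, y) chi (j * s x) * f (x - y) * chi (- (k * y))] in two ways
   therefore forces the coefficient to vanish. *)
Lemma char_perm_coef0 (j k : R) : k \notin [set j * val v | v in H] ->
  \sum_x chi (j * s x - k * x) = 0.
Proof.
set O := [set _ | _ in _] => kO.
(* The orbit [O] of [j] is stable under [H], so this sum of characters depends only on the [H]-orbit
   of [t]. *)
pose f t := \sum_(l in O) chi (- (l * t)).
have fM t v : v \in H -> f (t * val v) = f t.
  move=> Hv; rewrite /f [RHS](reindex_inj (mulIr (valP v))) /=.
  apply: eq_big => [l|l _]; last by rewrite mulrAC mulrA.
  apply/imsetP/imsetP => -[w Hw E].
    by exists (w * v)%g; rewrite ?groupM // E FinRing.val_unitM mulrA.
  exists (w * v^-1)%g; rewrite ?groupM ?groupV //.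
  rewrite FinRing.val_unitM FinRing.val_unitV mulrA -E mulrK //; exact: valP.
have fs x y : f (s x - s y) = f (x - y).
  by have [v Hv ->] := sP y x; rewrite fM.
have fhat l : \sum_t f t * chi (l * t) = if l \in O then #|R|%:R else 0.
  under eq_bigr do rewrite mulr_suml.
  rewrite exchange_big /=.
  under eq_bigr => l' _ do (under eq_bigr do rewrite -chiD addrC -mulrBl).
  under eq_bigr do rewrite char_sum subr_eq0 eq_sym.
  rewrite -big_mkcondr; case: ifP => lO.
    by rewrite (big_pred1 l) // => l' /=; case: eqP => [->|]; rewrite ?lO ?andbF.
  by rewrite big_pred0 // => l'; case: eqP => [->|]; rewrite ?lO ?andbF.
have jO : j \in O by apply/imsetP; exists 1%g; rewrite ?group1 //= mulr1.
apply: (mulfI cardR); rewrite mulr0.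
transitivity (\sum_x \sum_y chi (j * s x) * f (x - y) * chi (- (k * y))).
  rewrite exchange_big mulr_sumr; apply: eq_bigr => y _ /=.
  rewrite -mulr_suml chiD mulrA; congr (_ * _).
  under [RHS]eq_bigr => x _ do rewrite -fs.
  have := fhat j; rewrite jO => <-.
  rewrite (reindex_inj (addIr (- s y))) (reindex s) /=; last exact: onW_bij.
  rewrite mulr_suml; apply: eq_bigr => x _.
  by rewrite -mulrA -chiD -mulrDr subrK mulrC.
rewrite big1 // => x _.
have := fhat k; rewrite (negPf kO) => E.
under eq_bigr do rewrite -mulrA; rewrite -mulr_sumr.
(* Substituting y = x - t turns the inner sum into [chi (- (k * x))] times the transform of [f] at
   [k]. *)
rewrite (reindex_inj (inj_comp (addrI x) oppr_inj)) /=.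
rewrite (eq_bigr (fun t => chi (- (k * x)) * (f t * chi (k * t)))) => [|t _].
  by rewrite -mulr_sumr E !mulr0.
by rewrite opprD opprK addrA subrr add0r mulrDr mulrN opprD opprK chiD mulrCA.
Qed.

Hypothesis frob : forall u, u \in H -> exists2 U,
  val u = U%:R & [pchar F].-nat U.
Hypothesis no_midpoint : forall a b c, a \in H -> b \in H -> c \in H ->
  val a + val b = val c *+ 2 -> a = c.

Lemma color_preserving_affine :
  exists2 v, v \in H & forall x, s x = val v * x + s 0.
Proof.
have [a hE] : exists a : {unit R} -> F,
    forall x, chi (s x) = \sum_(v in H) a v * chi (val v * x).
  (* These are the Fourier coefficients of [chi \o s]; those at frequencies outside [H] vanish by
     [char_perm_coef0] with j = 1. *)
  exists (fun v => #|R|%:R^-1 * \sum_y chi (s y) * chi (- (val v * y))) => x.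
  have /= -> := char_inversion (chi \o s) x.
  rewrite (bigID (mem [set val v | v in H])) /=.
  rewrite [X in _ + X]big1 => [|k kH]; last first.
    have := @char_perm_coef0 1 k; rewrite (eq_imset _ (fun v => mul1r (val v))).
    move=> /(_ kH) E; rewrite (eq_bigr (fun x => chi (1 * s x - k * x))).
      by rewrite E mulr0 mul0r.
    by move=> y _; rewrite chiD mul1r.
  by rewrite addr0 big_imset //= => v w _ _; apply: val_inj.
have aM v w : v \in H -> w \in H -> v != w -> a v * a w = 0.
  move=> Hv Hw vw; pose u := (v * w^-1)%g.
  have Hu : u \in H by rewrite groupM ?groupV.
  have [U uU pU] := frob Hu.
  have wu : val w * val u = val v.
    by rewrite FinRing.val_unitM FinRing.val_unitV mulrC divrK //; apply: valP.
  have u1 : u != 1%g by apply: contra vw; rewrite /u -eq_mulgV1.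
  (* If 2v = (1 + u)z with z in [H], then v is the midpoint of z and uz, so z = v = uz, against u <>
     1. *)
  have : \sum_x chi ((1 + val u) * s x - (val v *+ 2) * x) = 0.
    apply: char_perm_coef0; apply/imsetP => -[z Hz].
    rewrite mulrDl mul1r -FinRing.val_unitM => /esym E.
    have Huz : (u * z)%g \in H by rewrite groupM.
    have e1 := no_midpoint Hz Huz Hv E.
    rewrite addrC in E; have e2 := no_midpoint Huz Hz Hv E.
    by case/negP: u1; rewrite -(inj_eq (mulIg z)) mul1g e2 e1.
  (* Since [U] represents [u] and the [U]-th power is additive on [F], [chi (u * s x)] is the sum of
     the [a k ^+ U * chi (k * u * x)]. *)
  rewrite (eq_bigr (fun x => \sum_(l in H) \sum_(k in H) a l * a k ^+ U *
      chi ((val l + val (k * u)%g - val v *+ 2) * x))) => [|x _]; last first.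
    rewrite chiD mulrDl mul1r chiD uU mulr_natl char_mulrn hE sum_exp_pchar //.
    rewrite 2!mulr_suml; apply: eq_bigr => l _.
    rewrite -mulrA mulr_suml mulr_sumr; apply: eq_bigr => k _.
    rewrite exprMn -char_mulrn FinRing.val_unitM uU -[_ *+ U]mulr_natr.
    rewrite -!mulrA; congr (_ * _); rewrite mulrCA; congr (_ * _).
    by rewrite -!chiD ![in RHS]mulrDl mulNr addrA mulrA mulrAC -!mulrA.
  (* Summing over x first keeps only the pairs with l + ku = 2v; then l = v and ku = v, that is k =
     w. *)
  rewrite exchange_big /=.
  under eq_bigr => l _ do rewrite exchange_big /=.
  under eq_bigr => l _ do (under eq_bigr do rewrite -mulr_sumr char_sum subr_eq0).
  rewrite (bigD1 v) //= [X in _ + X]big1 => [|l /andP[Hl lv]]; last first.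
    apply: big1 => k Hk; case: eqP => [E|]; last by rewrite mulr0.
    by case/eqP: lv; apply: (no_midpoint Hl (groupM Hk Hu) Hv).
  rewrite addr0 (bigD1 w) //= [X in _ + X]big1 => [|k /andP[Hk kw]]; last first.
    case: eqP => [E|]; last by rewrite mulr0.
    rewrite addrC in E; case/eqP: kw; apply: (mulIg u).
    rewrite (no_midpoint (groupM Hk Hu) Hv Hv) //.
    by apply: val_inj; rewrite /= wu.
  rewrite wu mulr2n eqxx addr0 => /eqP.
  rewrite mulf_eq0 (negPf cardR) orbF mulf_eq0 expf_eq0.
  by case/orP => [/eqP->|/andP[_ /eqP->]]; rewrite ?mul0r ?mulr0.
have chiN0 x : chi x != 0.
  apply/eqP => E; have := chi0; rewrite -(subrr x) chiD E mul0r => /esym/eqP.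
  by rewrite oner_eq0.
have [v Hv av] : exists2 v, v \in H & a v != 0.
  apply/exists_inP; apply: contraNT (chiN0 (s 0)); rewrite negb_exists_in.
  move/forall_inP => a0; rewrite hE big1 // => v /a0; rewrite negbK => /eqP ->.
  by rewrite mul0r.
have hv x : chi (s x) = a v * chi (val v * x).
  rewrite hE (bigD1 v) //= big1 ?addr0 // => w /andP[Hw wv].
  have /eqP := aM w v Hw Hv wv; rewrite mulf_eq0 (negPf av) orbF => /eqP ->.
  by rewrite mul0r.
(* At x = 0, [hv] reads [chi (s 0) = a v], so [chi (s x)] equals [chi (v * x + s 0)]. *)
exists v => // x; apply/eqP; rewrite -subr_eq0; apply/eqP.
apply: chi_inj; apply: (mulIf (chiN0 (val v * x + s 0))).
by rewrite -chiD subrK mul1r chiD !hv mulr0 chi0 mulr1 mulrC.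
Qed.

End ColorPreserving.
End AdditiveCharacter.

(** * Primitive roots, and sums of two powers of q modulo q^m - 1 *)

Lemma fin_field_prim_root (F : finFieldType) :
  exists w : F, #|F|.-1.-primitive_root%R w.
Proof.
have F_gt0 : 0 < #|F|.-1 by rewrite -subn1 subn_gt0 finRing_gt1.
have /hasP [w _ wP] :
    has #|F|.-1.-primitive_root%R (enum [pred x : F | x != 0%R]).
  apply: has_prim_root (F_gt0) _ (enum_uniq _) _; last first.
    by rewrite -cardE; have <- := cardC1 (0%R : F).
  apply/allP => x; rewrite mem_enum inE unity_rootE => x0.
  apply/eqP/(mulfI x0); rewrite -exprS prednK ?expf_card ?mulr1 //.
  exact: ltn_trans (finRing_gt1 F).
by exists w.
Qed.

(** As q >= 2, each of q^a and q^b is at most q^m / 2, so their sum minus 2 is below the modulus and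
    the congruence is an equality. *)
Lemma expn_midpoint_one q m a b : 1 < q -> a < m -> b < m ->
  q ^ a + q ^ b = 2 %[mod q ^ m - 1] -> a = 0.
Proof.
move=> q1 am bm /eqP.
have q0 : 0 < q by apply: ltnW.
have ge1 e : 0 < q ^ e by rewrite expn_gt0 q0.
have le e : e < m -> q ^ e * 2 <= q ^ m.
  move=> em; rewrite (leq_trans (leq_mul (leqnn _) q1)) // -expnSr.
  by rewrite leq_pexp2l.
have := ge1 a; have := ge1 b; have := le a am; have := le b bm => lb la gb ga.
rewrite eqn_mod_dvd; last by lia.
case: (posnP (q ^ a + q ^ b - 2)) => [E _|gt0 /(dvdn_leq gt0)]; last by lia.
have {E} /eqP : q ^ a = 1 by lia.
by rewrite -(expn0 q) eqn_exp2l // => /eqP.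
Qed.

Section ModularCycle.

Variables (q m : nat).
Let n := q ^ m - 1.
Hypotheses (q_gt1 : 1 < q) (m_gt0 : 0 < m) (n_gt1 : 1 < n).

(** Exponents reduce modulo m because q^m = 1 in ['Z_n]. The bound i < m is what [expn_midpoint_one]
    requires. *)
Lemma qgroupP (u : {unit 'Z_n}) :
  reflect (exists2 i, i < m & val u = (q ^ i)%:R%R) (u \in qgroup q n).
Proof.
have qm : q ^ m = n.+1 by rewrite /n; lia.
have qm1 : ((q ^ m)%:R = 1 :> 'Z_n)%R.
  by rewrite qm -natr1 pchar_Zp // add0r.
have qU : (q%:R : 'Z_n)%R \is a GRing.unit.
  rewrite unitZpE // coprime_sym -(@coprime_pexpl m) // qm.
  exact: coprimeSn.
pose g := FinRing.unit 'Z_n qU.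
have -> : qgroup q n = <[g]>%g.
  by congr <<_>>%g; apply/setP => x; rewrite !inE.
have gX i : val (g ^+ i)%g = (q ^ i)%:R%R.
  by rewrite FinRing.val_unitX /= natrX.
apply: (iffP (cycleP g u)) => [[i ->]|[i _ ui]]; last first.
  by exists i; apply: val_inj; rewrite gX.
exists (i %% m); first exact: ltn_pmod.
rewrite gX {1}(divn_eq i m) expnD [i %/ m * m]mulnC expnM.
by rewrite natrM (natrX _ (q ^ m)) qm1 expr1n mul1r.
Qed.

(** Dividing by [c] moves the midpoint to 1, where the equation is a congruence between powers of
    q. *)
Lemma qgroup_no_midpoint (a b c : {unit 'Z_n}) :
  a \in qgroup q n -> b \in qgroup q n -> c \in qgroup q n ->
  (val a + val b = val c *+ 2 -> a = c)%R.
Proof.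
move=> Ha Hb Hc E.
have qV x : x \in qgroup q n -> (c^-1 * x)%g \in qgroup q n.
  by move=> Hx; rewrite groupM ?groupV.
have [/qgroupP [i im iE] /qgroupP [j jm jE]] := (qV _ Ha, qV _ Hb).
have : ((q ^ i + q ^ j)%:R = 2%:R :> 'Z_n)%R.
  rewrite natrD -iE -jE !FinRing.val_unitM -mulrDr E.
  by rewrite FinRing.val_unitV -[(val c *+ 2)%R]mulr_natr mulKr //; apply: valP.
move/(congr1 (@nat_of_ord _)); rewrite !val_Zp_nat //.
move/(expn_midpoint_one q_gt1 im jm) => i0.
apply/esym/eqP; rewrite eq_mulVg1; apply/eqP/val_inj.
by rewrite iE i0.
Qed.

End ModularCycle.

(** * The two inclusions *)

Lemma cyc_colorM (q n : nat) (k : {unit 'Z_n}) (b x y : 'Z_n) :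
  k \in qgroup q n ->
  cyc_color q (val k * x + b)%R (val k * y + b)%R = cyc_color q x y.
Proof.
move=> Hk; rewrite /cyc_color opprD addrACA subrr addr0 -mulrBr.
apply/setP => z; apply/imsetP/imsetP => -[h Hh ->].
  by exists (k * h)%g; rewrite ?groupM // FinRing.val_unitM mulrCA mulrA.
exists (k^-1 * h)%g; first by rewrite groupM ?groupV.
rewrite FinRing.val_unitM mulrA [(val k * _)%R]mulrC FinRing.val_unitV.
by rewrite mulrK //; apply: valP.
Qed.

Lemma Aff_q_sub_Aut_q (q n : nat) : Aff_q q n \subset Aut_q q n.
Proof.
apply/subsetP => s; rewrite !inE => /andP[-> /exists_inP [k Hk]].
case/exists_inP => b _ /forall_inP sE; apply/forall_inP => x Hx.
apply/forall_inP => y Hy; rewrite (eqP (sE x Hx)) (eqP (sE y Hy)).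
by rewrite cyc_colorM.
Qed.

(** Length 1 is separate because ['Z_1] has two elements. A permutation preserving [Zp 1] = {0}
    fixes 0, so k = 1 and b = 0 serve. *)
Lemma Aut_q1_sub_Aff_q1 (q : nat) : Aut_q q 1 \subset Aff_q q 1.
Proof.
apply/subsetP => s; rewrite !inE => /andP[sS _]; rewrite sS /=.
apply/exists_inP; exists 1%g; first exact: group1.
apply/exists_inP; exists 0%R; first exact: group1.
apply/forall_inP => x; rewrite -(perm_closed x sS) mul1r addr0.
rewrite /Zp /= inE => /eqP s1.
by have := perm_closed x sS; rewrite /Zp /= !inE s1 eqxx => /esym/eqP ->.
Qed.

Lemma Aut_q_sub_Aff_q (q m : nat) : prime_power q -> 0 < m ->
  1 < q ^ m - 1 -> Aut_q q (q ^ m - 1) \subset Aff_q q (q ^ m - 1).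
Proof.
move=> [p [k [p_pr k_gt0 qE]]] m_gt0; set n := q ^ m - 1 => n_gt1.
have q_gt1 : 1 < q by rewrite qE -(exp1n k) ltn_exp2r // prime_gt1.
have qm : q ^ m = n.+1 by rewrite /n; lia.
have km_gt0 : 0 < k * m by rewrite muln_gt0 k_gt0.
(* [F] has q^m = n + 1 elements, so a generator [w] of its nonzero elements has order n and [chi] is
   an injective character of ['Z_n]. *)
have [F pF cardF] := pPrimePowerField p_pr km_gt0.
rewrite expnM -qE qm in cardF.
have [w] := fin_field_prim_root F; rewrite cardF /= => wP.
pose chi (x : 'Z_n) : F := (w ^+ (x : nat))%R.
have chi0 : (chi 0 = 1)%R by [].
have chiD x y : (chi (x + y) = chi x * chi y)%R.
  by rewrite -exprD /chi /= [X in _ %% X]Zp_cast // (prim_expr_mod wP).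
have chi_inj x : (chi x = 1)%R -> x = 0%R.
  move/eqP; rewrite -(expr0 w) (eq_prim_root_expr wP) mod0n modn_small.
    by move/eqP => x0; apply: val_inj.
  by have := ltn_ord x; rewrite [X in _ < X -> _]Zp_cast.
(* In [F], n + 1 = q^m is zero, so n = -1. *)
have cardZ : (#|'Z_n|%:R != 0 :> F)%R.
  rewrite card_ord Zp_cast //; apply/eqP => n0.
  have : p %| #|F| by rewrite cardF -qm qE -expnM dvdn_exp ?muln_gt0 ?k_gt0.
  rewrite (GRing.dvdn_pcharf pF) cardF -natr1 n0 add0r => /eqP/eqP.
  by rewrite oner_eq0.
apply/subsetP => s; rewrite !inE => /andP[sS /forall_inP sP]; rewrite sS /=.
have ZpT x : x \in Zp n by rewrite /Zp n_gt1 inE.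
pose H := [group of <<[set u : {unit 'Z_n} | val u == q%:R%R]>>%g].
have [|x y|u /(qgroupP q_gt1 m_gt0 n_gt1) [i _ ui]|a b c Ha Hb Hc|v Hv vE] :=
    @color_preserving_affine _ _ chi chi0 chiD chi_inj cardZ H s.
- exact: injF_bij perm_inj.
- have /forall_inP/(_ _ (ZpT y))/eqP E := sP _ (ZpT x).
  have : (s y - s x)%R \in cyc_color q (s x) (s y).
    by apply/imsetP; exists 1%g; rewrite ?group1 // mulr1.
  by rewrite E => /imsetP [v Hv ->]; exists v.
- exists (q ^ i) => //; rewrite qE pnatX pnatX; apply/orP; left; apply/orP; left.
  by rewrite pnatE.
- exact: (qgroup_no_midpoint q_gt1 m_gt0 n_gt1 Ha Hb Hc).
apply/exists_inP; exists v => //; apply/exists_inP; exists (s 0%R) => //.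
by apply/forall_inP => x _; rewrite vE.
Qed.

Theorem proposition5p10 (q m : nat) (hq : prime_power q) (hm : (1 <= m)%N) :
  ~ exceptional_length q (q ^ m - 1)%N
  /\ Aut_q q (q ^ m - 1)%N = Aff_q q (q ^ m - 1)%N.
Proof.
suff E : Aut_q q (q ^ m - 1) = Aff_q q (q ^ m - 1) by split=> // /(_ E).
apply/eqP; rewrite eqEsubset Aff_q_sub_Aut_q andbT.
have [gt1|le1] := ltnP 1 (q ^ m - 1); first exact: Aut_q_sub_Aff_q.
(* Here 1 < q^m <= 2, so q = 2 and m = 1. *)
suff -> : q ^ m - 1 = 1 by exact: Aut_q1_sub_Aff_q1.
have [p [k [p_pr k_gt0 qE]]] := hq.
have : 1 < q ^ m.
  by rewrite qE -expnM -(exp1n (k * m)) ltn_exp2r ?muln_gt0 ?k_gt0 ?prime_gt1.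
by move: le1; lia.
Qed.
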